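(* Let $d\geq 1$, let $G$ be a finite $d$--regular bipartite graph, and let $t\geq0$. Then $$\int\frac12\ln(1+tz^2)\,d\rho_G(z)\geq\int\frac12\ln(1+tz^2)\,d\rho_{\mathbb{T}_d}(z).$$
   Context: For a finite graph $G$ with $m_k(G)$ matchings of size $k$, the matching polynomial is $\mu(G,x)=\sum_k(-1)^km_k(G)x^{v(G)-2k}$, and the matching measure $\rho_G=\frac{1}{v(G)}\sum_{z:\mu(G,z)=0}\delta_z$ (zeros counted with multiplicity). $\rho_{\mathbb{T}_d}$ denotes the weak limit of $\rho_{G_i}$ for any sequence $(G_i)$ of finite $d$--regular graphs whose girth tends to infinity (this limit exists and does not depend on the sequence). *)

(* Defs.v *)
From HB Require Import structures.
From mathcomp Require Import all_boot all_order all_algebra.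
From mathcomp Require Import polyrcf.
From mathcomp Require Import reals exp.

Set Implicit Arguments.
Unset Strict Implicit.
Unset Printing Implicit Defensive.

Import Order.TTheory GRing.Theory Num.Theory.
Local Open Scope ring_scope.

Record fin_graph := FGraph { gV : finType; gE : rel gV }.
Arguments gE : clear implicits.

Definition simple_graph (G : fin_graph) : Prop :=
  symmetric (gE G) /\ irreflexive (gE G).

Definition nverts (G : fin_graph) : nat := #|gV G|.

Definition regular (d : nat) (G : fin_graph) : Prop :=
  forall x : gV G, #|[set y | gE G x y]| = d.

Definition bipartite (G : fin_graph) : Prop :=
  exists c : gV G -> bool, forall x y, gE G x y -> c x != c y.

Definition is_matching (G : fin_graph) (M : {set {set gV G}}) : bool :=
  [forall A in M, exists x, exists y, gE G x y && (A == [set x; y])] &&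
  [forall A in M, forall B in M, (A != B) ==> [disjoint A & B]].

Definition nmatchings (G : fin_graph) (k : nat) : nat :=
  #|[set M : {set {set gV G}} | is_matching M && (#|M| == k)]|.

Definition matching_poly (R : nzRingType) (G : fin_graph) : {poly R} :=
  \sum_(k < (nverts G)./2.+1)
     ((-1) ^+ k * (nmatchings G k)%:R) *: 'X^(nverts G - 2 * k).

(* integral of f against the matching measure
   rho_G = (1/v(G)) sum_{zeros z of mu(G,.)} delta_z  (zeros with multiplicity).
   By the Heilmann--Lieb theorem all zeros are real, so we sum over the real
   zeros (rootsR, distinct) weighted by their multiplicity (mup). *)
Definition int_rho (R : rcfType) (G : fin_graph) (f : R -> R) : R :=
  (nverts G)%:R^-1 *
  \sum_(z <- rootsR (matching_poly R G)) (mup z (matching_poly R G))%:R * f z.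

Definition has_cycle_of_len (G : fin_graph) (k : nat) : Prop :=
  exists s : seq (gV G), [/\ size s = k, (3 <= k)%N, uniq s & cycle (gE G) s].

Definition girth_to_infty (Gs : nat -> fin_graph) : Prop :=
  forall L : nat, exists N : nat, forall i : nat, (N <= i)%N ->
    forall k : nat, (k <= L)%N -> ~ has_cycle_of_len (Gs i) k.

(* admissible sequences defining rho_{T_d}: finite (nonempty) simple d-regular
   graphs with girth tending to infinity *)
Definition tree_approx_seq (d : nat) (Gs : nat -> fin_graph) : Prop :=
  (forall i, [/\ simple_graph (Gs i), regular d (Gs i) & (0 < nverts (Gs i))%N])
  /\ girth_to_infty Gs.

(* Main.v *)
(** Let [M(G)] be the generating function of the matchings of [G] in the activity
    [t]. By real-rootedness (Heilmann-Lieb) the integral of [ln (1 + t z^2) / 2]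
    against [rho_G] is [ln M(G) / v(G)], and both sides are compared with the Bethe
    value [ln (1 + t d x) - (d / 2) ln (1 + t x^2)], where [x + t (d - 1) x^2 = 1].

    Edges are traded one at a time for vertex weights: deleting [uv] while adding
    [t x e^s] to the weight of [u] and [t x e^-s] to that of [v]. In a bipartite graph,
    deleting a vertex makes vertices of the other colour more likely to be unmatched;
    hence for a suitable [s] each trade loses at most a factor [1 + t x^2]. When no edge
    is left the sum is a product of vertex weights, and by convexity it is least
    when all [s] vanish. This bounds [M(G)] from below.

    In a graph of large girth the same trades with [s = 0] are almost exact, because
    the probability that a vertex is unmatched is determined, up to an exponentially
    small error, by the tree recursion whose fixed point is [x]. *)

Require Import Defs.
From HB Require Import structures.
From mathcomp Require Import all_boot all_order all_algebra.
From mathcomp Require Import polyrcf complex.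
From mathcomp Require Import reals sequences exp.
From mathcomp Require Import ring lra zify.
Import Order.TTheory GRing.Theory Num.Theory.
Local Open Scope ring_scope.

Set Implicit Arguments.
Unset Strict Implicit.
Unset Printing Implicit Defensive.

(** * Weighted matching sums *)

Section MatchingSum.
Variables (V : finType).
Implicit Types (S e f : {set V}) (es : seq {set V}) (u v y : V).

(** Partition function of the matchings from [es] inside [S]: activity [t] per edge, weight [w v]
    per uncovered vertex. Recursion on a list suits trading edges one at a time; the ring is general
    because the matching polynomial is the case [t = -1], [w = 'X]. *)
Fixpoint matchsum (K : comNzRingType) (t : K) (w : V -> K) es S : K :=
  if es is e :: es' then
    matchsum t w es' S +
      (if e \subset S then t * matchsum t w es' (S :\: e) else 0)
  else \prod_(v in S) w v.

Lemma rmorph_matchsum (K L : comNzRingType) (g : {rmorphism K -> L}) t w es S :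
  g (matchsum t w es S) = matchsum (g t) (g \o w) es S.
Proof.
elim: es S => [|e es IH] S /=; first by rewrite rmorph_prod.
by rewrite rmorphD IH; case: ifP => _; rewrite ?rmorph0 // rmorphM IH.
Qed.

(** Homogeneity: a matching with k edges leaves [#|S| - 2k] vertices uncovered, so each term picks
    up the same power of [l]. *)
Lemma matchsum_scale (K : comNzRingType) (l t : K) w es S :
  {in es, forall e, #|e| = 2%N} ->
  matchsum (l ^+ 2 * t) (fun v => l * w v) es S = l ^+ #|S| * matchsum t w es S.
Proof.
elim: es S => [|e es IH] S He /=.
  by rewrite big_split /= prodr_const.
have Hes : {in es, forall e, #|e| = 2%N} by move=> f fes; apply: He; rewrite inE fes orbT.
rewrite !IH // mulrDr; congr (_ + _); case: ifP => eS; last by rewrite mulr0.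
have -> : #|S| = (2 + #|S :\: e|)%N.
  rewrite -(He e) ?mem_head // -(cardsID e S) (setIidPr _) //.
by rewrite exprD; ring.
Qed.

Lemma eq_matchsum (K : comNzRingType) (t : K) (w w' : V -> K) es S :
  {in S, w =1 w'} -> matchsum t w es S = matchsum t w' es S.
Proof.
elim: es S => [|e es IH] S Hw /=; first exact: eq_bigr.
rewrite IH //; congr (_ + _); case: ifP => // _; congr (_ * _); apply: IH.
by move=> v /setDP[vS _]; apply: Hw.
Qed.

(** Either [u] is uncovered or exactly one edge matches it. The full list [es] may stay on the
    right, since the other edges at [u] no longer fit once [u] has left the set. *)
Lemma matchsum_vertex (K : comNzRingType) (t : K) w es S u : u \in S ->
  matchsum t w es S = w u * matchsum t w es (S :\ u) +
    t * \sum_(e <- es | (u \in e) && (e \subset S)) matchsum t w es (S :\: e).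
Proof.
elim: es S => [|e es IH] S uS /=.
  by rewrite big_nil mulr0 addr0 (big_setD1 u).
rewrite big_cons (IH S uS); have [ue|ue] := boolP (u \in e) => /=; last first.
  rewrite big_split /=.
  have -> : (e \subset S :\ u) = (e \subset S).
    by rewrite subsetD1 ue andbT.
  have [eS|eS] := boolP (e \subset S); last first.
    rewrite [\sum_(f <- es | _) (if _ then _ else _)]big1; first by ring.
    move=> f /andP[_ fS]; rewrite ifN //; apply: contra eS => /subset_trans; apply.
    exact: subsetDl.
  rewrite (IH (S :\: e)); last by rewrite inE ue.
  rewrite setDDl setUC -setDDl.
  suff -> : \sum_(f <- es | (u \in f) && (f \subset S))
     (if e \subset S :\: f then t * matchsum t w es (S :\: f :\: e) else 0) =
     t * \sum_(f <- es | (u \in f) && (f \subset S :\: e)) matchsum t w es (S :\: e :\: f).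
    by ring.
  rewrite big_distrr /= -big_mkcondr /=; apply: eq_big => [f|f _].
    by rewrite -andbA !subsetD eS disjoint_sym.
  by rewrite !setDDl setUC.
have -> : (e \subset S :\ u) = false by rewrite subsetD1 ue andbF.
rewrite addr0.
have -> : \sum_(f <- es | (u \in f) && (f \subset S))
     (matchsum t w es (S :\: f) +
       (if e \subset S :\: f then t * matchsum t w es (S :\: f :\: e) else 0)) =
   \sum_(f <- es | (u \in f) && (f \subset S)) matchsum t w es (S :\: f).
  apply: eq_bigr => f /andP[uf _]; rewrite ifN ?addr0 //.
  by apply/negP => /subsetP/(_ u ue); rewrite inE uf.
case: ifP => eS; last by ring.
rewrite ifN; last by apply/negP => /subsetP/(_ u ue); rewrite inE ue.
ring.
Qed.

(** In the expansion at [u] only the first term contains [w u], so the sum is affine in each vertex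
    weight. *)
Lemma matchsum_field (K : comNzRingType) (t : K) (w w' : V -> K) es S u :
  u \in S -> {in S :\ u, w =1 w'} ->
  matchsum t w' es S = matchsum t w es S + (w' u - w u) * matchsum t w es (S :\ u).
Proof.
move=> uS Hw; rewrite (matchsum_vertex t w es uS) (matchsum_vertex t w' es uS).
rewrite -(eq_matchsum _ _ Hw).
rewrite [X in _ + t * X = _](eq_bigr (fun e => matchsum t w es (S :\: e))).
  ring.
move=> e /andP[ue _]; apply/esym/eq_matchsum => v /setDP[vS ve]; apply: Hw.
by rewrite !inE vS andbT; apply: contraNneq ve => ->.
Qed.

Lemma matchsum_field2 (K : comNzRingType) (t : K) (w w' : V -> K) es u v : u != v ->
  (forall y, y != u -> y != v -> w' y = w y) ->
  let Z := matchsum t w es in let a := w' u - w u in let b := w' v - w v in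
  matchsum t w' es setT =
    Z setT + a * Z (setT :\ u) + b * Z (setT :\ v) + a * b * Z (setT :\ u :\ v).
Proof.
move=> uv Hw Z a b; pose w1 y := if y == u then w' u else w y.
rewrite (@matchsum_field _ t w1 w' es setT v) ?inE //; last first.
  move=> y; rewrite !inE andbT /w1 => yv; case: eqP => [-> //|/eqP yu].
  by rewrite Hw.
have H S : u \in S -> matchsum t w1 es S = Z S + a * Z (S :\ u).
  move=> uS; rewrite (@matchsum_field _ t w w1 es S u) ?inE // /w1 ?eqxx //.
  by move=> y /setD1P[/negPf-> _].
rewrite !H ?inE ?uv // setDDl setUC -setDDl /w1 eq_sym (negPf uv) /b.
ring.
Qed.

End MatchingSum.

(** * Lower bound for bipartite graphs *)

Section Real.
Variables (R : realType) (V : finType) (t : R).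
Hypothesis t_ge0 : 0 <= t.
Implicit Types (S e f : {set V}) (es : seq {set V}) (u v y : V) (w : V -> R).

Lemma matchsum_ge0 w es S : (forall y, 0 <= w y) -> 0 <= matchsum t w es S.
Proof.
move=> w0; elim: es S => [|e es IH] S /=; first by apply: prodr_ge0.
by rewrite addr_ge0 //; case: ifP => // _; rewrite mulr_ge0.
Qed.

Lemma matchsum_gt0 w es S : (forall y, 0 < w y) -> 0 < matchsum t w es S.
Proof.
move=> w0; elim: es S => [|e es IH] S /=; first by apply: prodr_gt0.
by rewrite ltr_wpDr //; case: ifP => // _; rewrite mulr_ge0 // ltW.
Qed.

Definition proper_colouring (c : V -> bool) es :=
  {in es, forall e, exists u v, e = [set u; v] /\ c u != c v}.

Lemma proper_colouring_cons c e es :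
  proper_colouring c (e :: es) -> proper_colouring c es.
Proof. by move=> H f fes; apply: H; rewrite inE fes orbT. Qed.

Lemma proper_colouring_other c es e u : proper_colouring c es -> e \in es ->
  u \in e -> exists2 v, e = [set u; v] & c v = ~~ c u.
Proof.
move=> H /H[a [b [-> ab]]]; rewrite !inE => /orP[]/eqP->.
  by exists b => //; case: (c a) (c b) ab => [] [].
by exists a; [rewrite setUC | case: (c a) (c b) ab => [] []].
Qed.

(** Expanding [S] and [S :\ v] at [u] turns the difference of the two products into [t] times a sum,
    over edges from [u] to [a], of minus the same difference for [a], [v] in [S :\ u]. The colour of
    [a] is opposite to that of [u], so the sign alternates with the colour and induction on [#|S|]
    applies. *)
Lemma matchsum_correlation c w es S u v : proper_colouring c es ->
  (forall y, 0 <= w y) -> u \in S -> v \in S -> u != v ->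
  if c u == c v then
    matchsum t w es S * matchsum t w es (S :\ u :\ v) <=
    matchsum t w es (S :\ u) * matchsum t w es (S :\ v)
  else
    matchsum t w es (S :\ u) * matchsum t w es (S :\ v) <=
    matchsum t w es S * matchsum t w es (S :\ u :\ v).
Proof.
pose Z := matchsum t w es; rewrite -!/(Z _).
move=> cP w0.
have [n] := ubnP #|S|; elim: n => // n IH in S u v *.
rewrite ltnS => Sn uS vS uv.
have Z0 T : 0 <= Z T by apply: matchsum_ge0.
have uSv : u \in S :\ v by rewrite !inE uv.
have eZ : Z S = _ := matchsum_vertex t w es uS.
have eZv : Z (S :\ v) = _ := matchsum_vertex t w es uSv.
have Suv : S :\ v :\ u = S :\ u :\ v by rewrite !setDDl setUC.
rewrite -/Z Suv in eZv.
have Sun : (#|S :\ u| < n)%N by rewrite (cardsD1 u S) uS in Sn.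
pose F e := Z (S :\: e) * Z (S :\ u :\ v) -
  (if v \in e then 0 else Z (S :\ u) * Z (S :\ v :\: e)).
have dE : Z S * Z (S :\ u :\ v) - Z (S :\ u) * Z (S :\ v) =
    t * \sum_(e <- es | (u \in e) && (e \subset S)) F e.
  rewrite eZ eZv /F sumrB -mulr_suml.
  have -> : \sum_(e <- es | (u \in e) && (e \subset S))
      (if v \in e then 0 else Z (S :\ u) * Z (S :\ v :\: e)) =
    Z (S :\ u) * \sum_(e <- es | (u \in e) && (e \subset S :\ v)) Z (S :\ v :\: e).
    rewrite mulr_sumr big_mkcond [RHS]big_mkcond /=; apply: eq_bigr => e _.
    by rewrite subsetD1; case: (u \in e) (e \subset S) (v \in e) => [] [] [].
  rewrite -/Z; ring.
have eqC e : e \in es -> u \in e -> e \subset S ->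
   if c u == c v then F e <= 0 else 0 <= F e.
  move=> ees ue eS; have [a eE ca] := proper_colouring_other cP ees ue.
  have au : a != u by apply/eqP => au; move: ca; rewrite au; case: (c u).
  (* The edge joining [u] to [v] fits into [S] but not into [S :\ v], so its term is a product of
     nonnegative sums; it occurs only for opposite colours. *)
  rewrite /F; have [|ve] := boolP (v \in e).
    rewrite {1}eE !inE eq_sym (negPf uv) /= subr0 => /eqP ->.
    by rewrite ca; case: (c u) => /=; rewrite mulr_ge0.
  have av : a != v by apply: contraNneq ve => <-; rewrite eE !inE eqxx orbT.
  have aSu : a \in S :\ u by rewrite !inE au (subsetP eS) // eE !inE eqxx orbT.
  have vSu : v \in S :\ u by rewrite !inE eq_sym uv.
  have := IH _ _ _ Sun aSu vSu av; rewrite ca.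
  have -> : S :\: e = S :\ u :\ a by rewrite eE setDDl.
  have -> : S :\ v :\: e = S :\ u :\ a :\ v.
    by rewrite eE !setDDl setUC setUA.
  by case: (c u) (c v) => [] [] /=; rewrite ?subr_ge0 ?subr_le0 // mulrC.
case: ifP eqC => _ eqC.
  rewrite -subr_le0 dE mulr_ge0_le0 // big_seq_cond sumr_le0 // => e.
  by case/andP => ees /andP[ue eS]; apply: eqC.
rewrite -subr_ge0 dE mulr_ge0 // big_seq_cond sumr_ge0 // => e.
by case/andP => ees /andP[ue eS]; apply: eqC.
Qed.

(** Weight gathered at [y] once all edges are traded. Under a proper colouring the two ends of an
    edge receive reciprocal exponentials. *)
Definition edge_field (c : V -> bool) (x : R) (s : {set V} -> R) es y : R :=
  t * x * \sum_(e <- es | y \in e) expR (if c y then s e else - s e).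

Lemma edge_field_cons c x s e es y :
  edge_field c x s (e :: es) y =
  (if y \in e then t * x * expR (if c y then s e else - s e) else 0) +
  edge_field c x s es y.
Proof. by rewrite /edge_field big_cons; case: ifP => _; rewrite ?add0r // mulrDr. Qed.

(** Here [A], [B], [C], [D] stand for the sums with no vertex, both ends, the first end and the
    second end deleted. Taking e^(2s) = D/C makes both linear terms equal to t x sqrt(CD); their sum
    is at most 2 t x sqrt(AB), hence at most t (B + x^2 A) by AM-GM. *)
Lemma bethe_step (x A B C D : R) : 0 < x -> 0 < A -> 0 < B -> 0 < C -> 0 < D ->
  C * D <= A * B -> exists s,
  A + t * x * expR s * C + t * x * expR (- s) * D + t * x * expR s * (t * x * expR (- s)) * B
   <= (A + t * B) * (1 + t * x ^+ 2).
Proof.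
move=> x0 A0 B0 C0 D0 CD; exists (ln (Num.sqrt (D / C))).
have q0 : 0 < Num.sqrt (D / C) by rewrite sqrtr_gt0 divr_gt0.
rewrite expRN lnK ?posrE //; set q := Num.sqrt _ in q0 *.
have qE : q ^+ 2 * C = D by rewrite sqr_sqrtr ?divr_ge0 ?ltW // divfK ?gt_eqF.
have -> : t * x * q * (t * x * q^-1) * B = t ^+ 2 * x ^+ 2 * B.
  by field; rewrite gt_eqF.
have -> : t * x * q^-1 * D = t * x * q * C by rewrite -qE; field; rewrite gt_eqF.
have H : 2 * x * (q * C) <= B + x ^+ 2 * A.
  have pq : 0 <= q * C by rewrite mulr_ge0 ?ltW.
  have pB : 0 <= B + x ^+ 2 * A by rewrite addr_ge0 ?mulr_ge0 ?exprn_ge0 // ltW.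
  rewrite -(@ler_pXn2r _ 2) ?nnegrE //; last by rewrite !mulr_ge0 // ltW.
  apply: (@le_trans _ _ (4 * x ^+ 2 * (A * B))); last first.
    by have := sqr_ge0 (B - x ^+ 2 * A); nra.
  have -> : (2 * x * (q * C)) ^+ 2 = 4 * x ^+ 2 * (C * D) by rewrite -qE; ring.
  by rewrite ler_wpM2l // mulr_ge0 // exprn_ge0 // ltW.
have := ler_wpM2l t_ge0 H; nra.
Qed.

(* Trading the edge [uv] for vertex weights [t x e^s] at [u] and [t x e^-s] at
   [v] costs at most a factor [1 + t x^2] once [s] balances the two linear
   terms; this is where the correlation inequality enters. *)
Lemma matchsum_ge_field c w es (x : R) : proper_colouring c es -> uniq es ->
  (forall y, 0 < w y) -> 0 < x ->
  exists s, \prod_y (w y + edge_field c x s es y) <=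
    matchsum t w es setT * (1 + t * x ^+ 2) ^+ size es.
Proof.
move=> + + + x0; elim: es w => [|e es IH] w cP /=.
  move=> _ w0; exists (fun=> 0); rewrite mulr1 [leLHS](eq_bigr w) //; last first.
    by move=> y _; rewrite /edge_field big_nil mulr0 addr0.
  by rewrite [leRHS](eq_bigl xpredT) // => y; rewrite inE.
case/andP => ees ues w0.
have [u [v [eE cu cv]]] : exists u v, [/\ e = [set u; v], c u & ~~ c v].
  have [a [b [-> cab]]] := cP e (mem_head _ _).
  case ca: (c a) cab => cab; [exists a, b|exists b, a; rewrite setUC].
    by rewrite ca; split => //; case: (c b) cab.
  by rewrite ca; split => //; case: (c b) cab.
have uv : u != v by apply: contraNneq cv => <-.
have Z0 S : 0 < matchsum t w es S by apply: matchsum_gt0.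
have cor := matchsum_correlation (proper_colouring_cons cP) (fun y => ltW (w0 y))
  (in_setT u) (in_setT v) uv.
rewrite /= cu (negPf cv) /= in cor.
have [s0 Hs0] := bethe_step x0 (Z0 _) (Z0 _) (Z0 _) (Z0 _) cor.
(* The weights after trading [e]; the induction runs over all positive [w] so that it can continue
   from these. *)
pose w' y := w y + (if y \in e then t * x * expR (if c y then s0 else - s0) else 0).
have w'0 y : 0 < w' y.
  rewrite /w' ltr_wpDr //; case: ifP => // _.
  by rewrite !mulr_ge0 ?expR_ge0 // ltW.
have [s Hs] := IH w' (proper_colouring_cons cP) ues w'0.
exists (fun f => if f == e then s0 else s f).
rewrite (eq_bigr (fun y => w' y + edge_field c x s es y)); last first.
  move=> y _; rewrite edge_field_cons eqxx addrA; congr (_ + _ * _).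
  rewrite [LHS]big_seq_cond [RHS]big_seq_cond; apply: eq_bigr => f /andP[fes _].
  by have -> : (f == e) = false by apply/eqP => fe; rewrite fe (negPf ees) in fes.
apply: le_trans Hs _.
rewrite [_ ^+ (size es).+1]exprS [leRHS]mulrA ler_wpM2r //.
  by rewrite exprn_ge0 // addr_ge0 // mulr_ge0 // sqr_ge0.
rewrite subsetT (matchsum_field2 t (w := w) _ uv); last first.
  by move=> y yu yv; rewrite /w' eE !inE (negPf yu) (negPf yv) addr0.
have w'E y : y \in e -> w' y - w y = t * x * expR (if c y then s0 else - s0).
  by move=> ye; rewrite /w' ye; ring.
rewrite !w'E ?eE ?set21 ?set22 // cu (negPf cv) -setDDl.
exact: Hs0.
Qed.

(** After all trades each vertex carries 1 plus [d] exponentials. Convexity bounds this below by one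
    exponential of a linear form in [s]; these forms sum to zero over the vertices, as every edge
    has one end of each colour, which leaves the value at [s = 0]. *)
Lemma bethe_lower_bound c es (x : R) (d : nat) : proper_colouring c es -> uniq es ->
  0 < x -> (forall y, count (fun e => y \in e) es = d) ->
  (1 + t * d%:R * x) ^+ #|V| <=
    matchsum t (fun=> 1) es setT * (1 + t * x ^+ 2) ^+ size es.
Proof.
move=> cP ues x0 deg.
have [s Hs] := matchsum_ge_field cP ues (fun=> ltr01) x0.
apply: le_trans Hs.
set a := t * x; have a0 : 0 <= a by rewrite mulr_ge0 // ltW.
have -> : t * d%:R * x = d%:R * a by rewrite /a; ring.
set b := 1 + d%:R * a; have b0 : 0 < b by rewrite ltr_wpDr // mulr_ge0.
pose sg y e := if c y then s e else - s e.
(* Jensen with weight 1 at exponent 0 and weight [a] at each of the [d] exponents, [b] in total. The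
   weighted mean is [m]; once [expR m] is factored out, the linear parts of the bounds e^z >= 1 + z
   cancel. *)
have amgm y : b * expR (a / b * \sum_(e <- es | y \in e) sg y e) <=
    1 + edge_field c x s es y.
  rewrite /edge_field -/a; set m := a / b * _.
  have -> : 1 + a * \sum_(e <- es | y \in e) expR (sg y e) = expR m *
      (expR (- m) + a * \sum_(e <- es | y \in e) expR (sg y e - m)).
    rewrite mulrDr -expRD subrr expR0 [expR m * (a * _)]mulrCA [expR m * _]mulr_sumr; congr (_ + _ * _).
    by apply: eq_bigr => e _; rewrite -expRD addrC subrK.
  rewrite mulrC ler_pM2l ?expR_gt0 //.
  have H1 := expR_ge1Dx (- m).
  have H2 : \sum_(e <- es | y \in e) (1 + (sg y e - m)) <=
     \sum_(e <- es | y \in e) expR (sg y e - m).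
    by apply: ler_sum => e _; apply: expR_ge1Dx.
  have := ler_wpM2l a0 H2.
  rewrite big_split sumrB /= !big_const_seq !iter_addr_0 deg.
  rewrite mulrDr mulrBr.
  have -> : a * \sum_(e <- es | y \in e) sg y e = b * m.
    by rewrite /m; field; rewrite gt_eqF.
  rewrite -[m *+ d]mulr_natr /b; nra.
apply: le_trans (_ : \prod_y (b * expR (a / b * \sum_(e <- es | y \in e) sg y e)) <= _);
  last first.
  by apply: ler_prod => y _; rewrite amgm mulr_ge0 ?expR_ge0 // ltW.
rewrite big_split /= prodr_const -expR_sum -mulr_sumr (exchange_big_dep xpredT) //=.
rewrite [\sum_(e <- es) _]big_seq [\sum_(e <- es | _) _]big1 ?mulr0 ?expR0 ?mulr1 // => e.
case/cP => u [v [eE cuv]].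
rewrite eE (eq_bigl (mem [set u; v])) // big_setU1 /=; last first.
  by rewrite inE; apply: contraNneq cuv => ->.
by rewrite big_set1 /sg; case: (c u) (c v) cuv => [] []; rewrite ?subrr ?addNr.
Qed.

End Real.

(** * Upper bound for graphs of large girth *)

Section Edges.
Variable G : fin_graph.
Hypothesis sG : simple_graph G.
Implicit Types (u v y : gV G) (e : {set gV G}).

Lemma gE_neq u v : gE G u v -> u != v.
Proof. by move=> uv; apply/eqP => E; move: uv; rewrite E sG.2. Qed.

Lemma set2_inj u v z : u != z -> [set u; v] = [set u; z] -> v = z.
Proof.
move=> uz /setP/(_ z); rewrite !inE eqxx orbT eq_sym (negPf uz) /=.
by move/eqP.
Qed.

Definition edges : seq {set gV G} :=
  enum [set A | [exists x, [exists y, gE G x y && (A == [set x; y])]]].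

Lemma edges_uniq : uniq edges. Proof. exact: enum_uniq. Qed.

Lemma edgesP e : reflect (exists u v, gE G u v /\ e = [set u; v]) (e \in edges).
Proof.
rewrite mem_enum inE; apply: (iffP existsP) => [[u /existsP[v /andP[uv /eqP->]]]|].
  by exists u, v.
by move=> [u [v [uv ->]]]; exists u; apply/existsP; exists v; rewrite uv eqxx.
Qed.

Lemma mem_edges_other e u : e \in edges -> u \in e ->
  exists2 v, gE G u v & e = [set u; v].
Proof.
case/edgesP => a [b [ab ->]]; rewrite !inE => /orP[]/eqP->; first by exists b.
by exists a; [rewrite sG.1 | rewrite setUC].
Qed.

Lemma edges_set2 u v : ([set u; v] \in edges) = gE G u v.
Proof.
apply/idP/idP => [H|uv]; last by apply/edgesP; exists u, v.
have [z uz E] := mem_edges_other H (set21 u v).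
by rewrite (set2_inj (gE_neq uz) E).
Qed.

Lemma card_edge e : e \in edges -> #|e| = 2%N.
Proof. by case/edgesP => u [v [uv ->]]; rewrite cards2 gE_neq. Qed.

Lemma count_edges (d : nat) u : regular d G -> count (fun e => u \in e) edges = d.
Proof.
move=> rG; rewrite -(rG u) -size_filter.
rewrite -(card_in_imset (f := fun v => [set u; v])); last first.
  move=> v z; rewrite !inE => uv uz; apply: set2_inj; exact: gE_neq.
have fu : uniq [seq e : {set gV G} <- edges | u \in e] by rewrite filter_uniq // edges_uniq.
rewrite -(card_uniqP fu); apply: eq_card => e; rewrite mem_filter.
apply/andP/imsetP => [[ue /mem_edges_other-/(_ u ue)[v uv ->]]|[v]].
  by exists v; rewrite // inE.
by rewrite inE => uv ->; rewrite edges_set2 uv set21.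
Qed.

Lemma handshake (d : nat) : regular d G -> (size edges * 2 = nverts G * d)%N.
Proof.
move=> rG; rewrite /nverts -sum_nat_const.
transitivity (\sum_(u : gV G) count (fun e => u \in e) edges)%N; last first.
  by apply: eq_bigr => u _; apply: count_edges.
under eq_bigr => u _ do rewrite -sum1_count.
rewrite (exchange_big_dep xpredT) //= (big_seq_cond xpredT).
rewrite [RHS](eq_bigr (fun=> 2%N)); last first.
  by move=> e /andP[ee _]; rewrite sum1_card card_edge.
by rewrite -big_seq_cond big_const_seq iter_addn_0 count_predT mulnC.
Qed.

End Edges.

(** * Contraction of the tree recursion and the cost of a trade with [s = 0] *)

Section LargeGirth.
Variables (R : realType) (t x : R) (d L : nat) (G : fin_graph).
Hypotheses (t_ge0 : 0 <= t) (x_gt0 : 0 < x).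
Hypothesis xE : x + t * d.-1%:R * x ^+ 2 = 1.
Hypotheses (sG : simple_graph G) (rG : regular d G).
Hypothesis girth : forall k, (k <= L)%N -> ~ has_cycle_of_len G k.
Implicit Types (S e f : {set gV G}) (es done : seq {set gV G}) (u v y h z : gV G).

Let x_le1 : x <= 1.
Proof. by rewrite -xE lerDl !mulr_ge0 // ltW. Qed.

(** Vertex weights once the edges of [done] have been traded with [s = 0]. *)
Let w done y : R := 1 + t * x * (count (fun e => y \in e) done)%:R.

Let w_ge1 done y : 1 <= w done y.
Proof. by rewrite lerDl !mulr_ge0 // ltW. Qed.

Lemma matchsum_mono (w0 : gV G -> R) es S S' : (forall y, 1 <= w0 y) ->
  S' \subset S -> matchsum t w0 es S' <= matchsum t w0 es S.
Proof.
move=> w1; have w00 y : 0 <= w0 y by apply: le_trans (w1 y).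
elim: es S S' => [|e es IH] S S' sS /=.
  rewrite [leRHS](big_setID S') /= (setIidPr sS) ler_peMr ?prodr_ge0 //.
  elim/big_rec: _ => // y p _ p1; by rewrite -[1]mulr1 ler_pM.
rewrite lerD ?IH //; have [eS'|_] := boolP (e \subset S').
  by rewrite (subset_trans eS' sS) ler_wpM2l // IH // setSD.
by case: ifP => // _; rewrite mulr_ge0 // matchsum_ge0.
Qed.

(** The ratio [Z (S :\ y) / Z S] agrees with [x] up to a factor [K] either way. By [xE], [x] is the
    fixed point of the recursion r = 1 / (1 + t (d - 1) r) for this ratio on a tree. *)
Definition ratio_near done es K S y :=
  let Z := matchsum t (w done) es in
  Z (S :\ y) <= K * x * Z S /\ x * Z S <= K * Z (S :\ y).

(** Crude start of the recursion: every edge term at [y] is at most [Z (S :\ y)], so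
    [Z S / Z (S :\ y)] lies between 1 and 1 + t d, while x <= 1 <= (1 + t d) x by [xE]. *)
Lemma ratio_near0 done es S y : y \in S ->
  (count (fun e => y \in e) done + count (fun e => y \in e) es <= d)%N ->
  ratio_near done es (1 + t * d%:R) S y.
Proof.
move=> yS deg; rewrite /ratio_near /=; set Z := matchsum _ _ _.
have Z0 T : 0 < Z T by apply: matchsum_gt0 => // z; apply: lt_le_trans (w_ge1 _ _).
have le1 : Z (S :\ y) <= Z S by apply: matchsum_mono; rewrite ?subsetDl.
have le2 : Z S <= (1 + t * d%:R) * Z (S :\ y).
  rewrite /Z (matchsum_vertex t _ es yS) -/Z.
  have : \sum_(e <- es | (y \in e) && (e \subset S)) Z (S :\: e) <=
      \sum_(e <- es | y \in e) Z (S :\ y).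
    rewrite big_mkcondr ler_sum // => e ye; case: ifP => _; last exact: ltW.
    by apply: matchsum_mono => //; rewrite setDS // sub1set.
  rewrite big_const_seq iter_addr_0 -mulr_natr => /(ler_wpM2l t_ge0).
  move: deg; rewrite -(ler_nat R) natrD /w => deg.
  have := ler_wpM2l t_ge0 deg; have := ler_wpM2r (ltW (Z0 (S :\ y))) x_le1.
  have := mulr_ge0 t_ge0 (ler0n R (count (fun e => y \in e) done)).
  have := Z0 (S :\ y); nra.
split.
  apply: (le_trans le1); rewrite ler_peMl ?(ltW (Z0 _)) // -[leLHS]xE.
  have dd : (d.-1%:R : R) <= d%:R by rewrite ler_nat leq_pred.
  have h1 := ler_wpM2l t_ge0 dd.
  have h2 : x ^+ 2 <= x by rewrite expr2 ler_piMl // ltW.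
  have h3 := mulr_ge0 t_ge0 (ler0n R d.-1).
  have h4 := ler_wpM2l h3 h2.
  have h5 := ler_wpM2r (ltW x_gt0) h1.
  by rewrite mulrDl mul1r lerD2l (le_trans h4).
by apply: le_trans le2; rewrite ler_piMl ?(ltW (Z0 _)).
Qed.

(** The inverse ratio at [y] is 1 plus [d - 1] contributions: exactly [t * x] from a traded edge,
    [t * x] up to a factor [K] from a usable one. With c = t (d - 1) and c x^2 = 1 - x, multiplying
    by [x] gives a value between x + (1 - x)/K and x + (1 - x) K, so the error [K - 1] shrinks by
    the factor [1 - x]. *)
Lemma ratio_near_step done es K S y : y \in S -> 1 <= K ->
  (count (fun e => y \in e) done +
   count (fun e => (y \in e) && (e \subset S)) es = d.-1)%N ->
  (forall f z, f \in es -> f = [set y; z] -> f \subset S ->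
    ratio_near done es K (S :\ y) z) ->
  {in es, forall f, y \in f -> exists z, f = [set y; z]} ->
  ratio_near done es (1 + (1 - x) * (K - 1)) S y.
Proof.
move=> yS K1 deg nearK es2.
have K0 : 0 < K by apply: lt_le_trans K1.
rewrite /ratio_near /=; set Z := matchsum _ _ _.
have Z0 T : 0 < Z T by apply: matchsum_gt0 => // z; apply: lt_le_trans (w_ge1 _ _).
set Sg := \sum_(f <- es | (y \in f) && (f \subset S)) Z (S :\: f).
have eZ : Z S = w done y * Z (S :\ y) + t * Sg := matchsum_vertex t _ es yS.
pose N : R := (count (fun e => (y \in e) && (e \subset S)) es)%:R.
have N0 : 0 <= N := ler0n _ _.
have near f : f \in es -> (y \in f) && (f \subset S) ->
    Z (S :\: f) <= K * x * Z (S :\ y) /\ K^-1 * (x * Z (S :\ y)) <= Z (S :\: f).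
  move=> fes /andP[yf fS]; have [z fE] := es2 f fes yf.
  have [] := nearK f z fes fE fS; rewrite -/Z setDDl -fE => h1 h2.
  by rewrite ler_pdivrMl.
have up : Sg <= N * (K * x * Z (S :\ y)).
  rewrite mulr_natl -iter_addr_0 -big_const_seq /Sg big_seq_cond [leRHS]big_seq_cond.
  by apply: ler_sum => f /andP[fes fP]; case: (near f fes fP).
have lo : N * (K^-1 * (x * Z (S :\ y))) <= Sg.
  rewrite mulr_natl -iter_addr_0 -big_const_seq /Sg big_seq_cond [leRHS]big_seq_cond.
  by apply: ler_sum => f /andP[fes fP]; case: (near f fes fP).
have degR : (count (fun e => y \in e) done)%:R = d.-1%:R - N :> R.
  by rewrite -deg natrD addrK.
have r0 : 0 <= d.-1%:R - N by rewrite -degR.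
have eW : w done y = 1 + t * x * (d.-1%:R - N) by rewrite /w degR.
set T := Z (S :\ y) in eZ up lo *; have T0 : 0 < T := Z0 _.
have ki : K^-1 <= 1 by rewrite invf_le1.
pose c := t * d.-1%:R; have c0 : 0 <= c by rewrite mulr_ge0.
have xcE : x + c * x ^+ 2 = 1 := xE.
have UP : Z S <= (1 + c * x * K) * T.
  rewrite eZ eW; have h1 := ler_wpM2l t_ge0 up.
  have h2 : t * x * (d.-1%:R - N) * T <= t * x * (d.-1%:R - N) * T * K.
    by rewrite ler_peMr // !mulr_ge0 // ltW.
  apply: le_trans (lerD (lexx _) h1) _; rewrite mulrDl mul1r /c; lra.
have LO : (1 + c * x / K) * T <= Z S.
  rewrite eZ eW; have h1 := ler_wpM2l t_ge0 lo.
  have h2 : t * x * (d.-1%:R - N) * T * K^-1 <= t * x * (d.-1%:R - N) * T.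
    by rewrite ler_piMr // !mulr_ge0 // ltW.
  apply: le_trans _ (lerD (lexx _) h1); rewrite mulrDl mul1r /c; lra.
have cxx : c * x * x = 1 - x by rewrite -[1 in RHS]xcE; ring.
have r1 : 0 <= 1 - x by rewrite subr_ge0.
split.
  (* Weighted AM-HM without division: the reciprocal of x + (1 - x)/K is at most 1 + (1 - x)(K - 1),
     because 1/K <= x + (1 - x)/K. *)
  have -> : T = (x + (1 - x) / K) * T + (1 - x) * (1 - K^-1) * T by ring.
  have h : x * ((1 + c * x / K) * T) = (x + (1 - x) / K) * T.
    by rewrite -cxx; field; rewrite gt_eqF.
  have h1 : (x + (1 - x) / K) * T <= x * Z S by rewrite -h ler_wpM2l // ltW.
  have h2 : (1 - x) * (1 - K^-1) * T <= (1 - x) * (K - 1) * ((x + (1 - x) / K) * T).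
    have -> : (1 - x) * (1 - K^-1) * T = (1 - x) * T * (K - 1) * K^-1.
      by field; rewrite gt_eqF.
    have -> : (1 - x) * (K - 1) * ((x + (1 - x) / K) * T) =
      (1 - x) * T * (K - 1) * (x + (1 - x) / K) by ring.
    have TK : 0 <= (1 - x) * T * (K - 1) by rewrite !mulr_ge0 ?subr_ge0 ?(ltW T0).
    apply: ler_wpM2l => //.
    have : 0 <= x * (1 - K^-1) by rewrite mulr_ge0 ?subr_ge0 // ltW.
    lra.
  apply: le_trans (lerD (lexx _) h2) _.
  rewrite -[X in X + _]mul1r -mulrDl -mulrA ler_wpM2l //.
  by rewrite addr_ge0 // mulr_ge0 // subr_ge0.
apply: le_trans (ler_wpM2l (ltW x_gt0) UP) _.
rewrite mulrA ler_wpM2r ?(ltW T0) // mulrDr mulr1 [x * _]mulrC.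
have -> : c * x * K * x = (1 - x) * K by rewrite -cxx; ring.
lra.
Qed.

Section Path.
Variables (done es : seq {set gV G}) (e : {set gV G}).
Hypothesis splitE : edges G = done ++ e :: es.

Let memE f : f \in e :: es -> f \in edges G.
Proof. by rewrite splitE mem_cat => ->; rewrite orbT. Qed.

Let uE : uniq (e :: es).
Proof. by have := edges_uniq G; rewrite splitE cat_uniq => /and3P[]. Qed.

Let degE y :
  (count (fun f => y \in f) done + ((y \in e) + count (fun f => y \in f) es) = d)%N.
Proof. by rewrite -(count_edges sG y rG) splitE count_cat. Qed.

(* The path runs backwards from [y] to the edge [e]; [S] lacks every vertex of
   the path through which the recursion arrived, and the girth keeps the
   remaining neighbours of [y] off the path, so exactly [d - 1] of the edges at
   [y] are either already traded for weights or still usable inside [S]. *)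
Lemma ratio_near_path n q y h S :
  uniq [:: y, h & q] -> path (gE G) y (h :: q) -> (n + size q < L.-1)%N ->
  [set y; h] \in e :: es -> (y \in e -> e = [set y; h]) ->
  e \subset [:: y, h & q] -> (h \in S -> [set y; h] \notin es) ->
  y \in S -> (forall z, z \notin [:: y, h & q] -> z \in S) ->
  ratio_near done es (1 + (1 - x) ^+ n * (t * d%:R)) S y.
Proof.
elim: n q y h S => [|n IH] q y h S uq pq sz yhE ye eq hS yS outS.
  rewrite expr0 mul1r; apply: ratio_near0 => //.
  by rewrite -(degE y) leq_add2l leq_addl.
(* A neighbour of [y] further along the path would close a cycle of length at most [size q + 2],
   which is below [L]. *)
have offpath f z : f \in es -> f = [set y; z] -> z != h -> z \notin [:: y, h & q].
  move=> fes fE zh; have yz : gE G y z.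
    by rewrite -edges_set2 // -fE memE // inE fes orbT.
  rewrite !inE (negPf zh) eq_sym (negPf (gE_neq sG yz)) /=.
  apply/negP => zq; case/splitPr: zq uq pq sz => q1 q2 uq pq sz.
  apply: (girth (k := size [:: y, h & rcons q1 z])).
    by move: sz; rewrite size_cat /= size_rcons; clear; lia.
  exists [:: y, h & rcons q1 z]; split => //.
  - by rewrite /= size_rcons.
  - by move: uq; rewrite -cat_rcons -!cat_cons cat_uniq => /and3P[].
  - rewrite /= rcons_path last_rcons (sG.1 z y) yz andbT.
    by move: pq; rewrite -cat_rcons /= cat_path => /andP[-> /andP[]].
have es2 : {in es, forall f, y \in f -> exists z, f = [set y; z]}.
  move=> f fes yf; have [||z _ fE] := @mem_edges_other _ sG f y; last by exists z.
    by rewrite memE // inE fes orbT.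
  by [].
have inS f z : f \in es -> f = [set y; z] -> f \subset S -> z != h.
  move=> fes fE fS; apply/eqP => zh; move: (hS); rewrite -zh -fE fes => H.
  by have := H (subsetP fS z _); rewrite fE set22; move/(_ isT).
have -> : 1 + (1 - x) ^+ n.+1 * (t * d%:R) =
   1 + (1 - x) * (1 + (1 - x) ^+ n * (t * d%:R) - 1) by rewrite exprS; ring.
apply: ratio_near_step => //.
- by rewrite lerDl !mulr_ge0 // exprn_ge0 // subr_ge0.
- have E1 : (count (fun f => y \in f) es =
     count (fun f => (y \in f) && (f \subset S)) es + ([set y; h] \in es))%N.
    rewrite -count_uniq_mem; last by case/andP: uE.
    rewrite -[LHS]addn0 -(count_pred0 es) -[RHS]count_predUI; congr (_ + _)%N.
      apply: eq_in_count => f fes /=; apply/idP/orP => [yf|]; last first.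
        by case=> [/andP[] //|/eqP->]; rewrite set21.
      have [z fE] := es2 f fes yf; have [<-|zh] := eqVneq z h.
        by right; rewrite fE.
      left; rewrite yf; apply/subsetP => a; rewrite fE !inE => /orP[]/eqP->//.
      exact/outS/(offpath f).
    apply: eq_in_count => f fes /=; apply/esym/negP => /andP[/andP[yf fS] /eqP fE].
    by have := inS f h fes fE fS; rewrite eqxx.
  (* The edge back to [h] is either [e] itself or a member of [es], and in the latter case [e]
     misses [y]. This is the one edge that separates [d] from [d - 1]. *)
  have E2 : ((y \in e) + ([set y; h] \in es) = 1)%N.
    move: yhE uE; rewrite inE /= => /orP[/eqP <-|H] /andP[ee _].
      by rewrite set21 (negPf ee).
    rewrite H; case yE : (y \in e) => //.
    by rewrite (ye yE) H in ee.
  by move: (degE y) E1 E2; clear; lia.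
- move=> f z fes fE fS; have zh := inS f z fes fE fS.
  have zq := offpath f z fes fE zh; have zy : z != y by move: zq; rewrite inE negb_or => /andP[].
  have zyE : [set z; y] = f by rewrite fE setUC.
  have ze : z \notin e by apply: contra zq => ze; apply: (subsetP eq).
  apply: (IH (h :: q) z y).
  + by rewrite cons_uniq zq.
  + by rewrite /= -(edges_set2 sG z y) zyE memE // inE fes orbT.
  + by move: sz; clear => /=; lia.
  + by rewrite zyE inE fes orbT.
  + by rewrite (negPf ze).
  + by apply: subset_trans eq _; apply/subsetP => a; rewrite !inE => ->; rewrite orbT.
  + by rewrite !inE eqxx.
  + by rewrite !inE zy (subsetP fS) // fE set22.
  + move=> a; rewrite !inE negb_or => /andP[_ aq].
    by rewrite (outS a) ?inE // andbT; move: aq; rewrite negb_or => /andP[].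
Qed.

(** Expanding both sides, the loss is t (B + x^2 A - x C - x D), with [A], [B], [C], [D] the sums
    with no vertex, both ends, one end and the other end of [e] deleted. It vanishes when C = D = x
    A and B = x^2 A, and the ratios are within [1 + k] of these values. *)
Lemma field_step n : (n.+1 < L.-1)%N -> let k := (1 - x) ^+ n * (t * d%:R) in
  k <= 1 ->
  (1 + t * x ^+ 2) * matchsum t (w done) (e :: es) setT <=
   (1 + 5 * t * k) * matchsum t (w (rcons done e)) es setT.
Proof.
move=> nL k k1.
have /edgesP[u [v [uv eE]]] : e \in edges G by rewrite memE // mem_head.
have uv' := gE_neq sG uv.
have k0 : 0 <= k by rewrite !mulr_ge0 // exprn_ge0 // subr_ge0.
have ees : e \notin es by case/andP: uE.
set Z := matchsum t (w done) es.
have Z0 T : 0 < Z T by apply: matchsum_gt0 => // z; apply: lt_le_trans (w_ge1 _ _).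
have near a b S : gE G a b -> e = [set a; b] -> a \in S ->
   (forall z, z \notin [:: a; b] -> z \in S) -> ratio_near done es (1 + k) S a.
  move=> ab abE aS outS; apply: (ratio_near_path (q := [::]) (h := b)) => //.
  - by rewrite /= inE gE_neq.
  - by rewrite /= ab.
  - by rewrite addn0; apply: ltn_trans nL.
  - by rewrite -abE mem_head.
  - by rewrite abE; apply/subsetP => z; rewrite !inE.
  - by rewrite -abE.
have vuE : e = [set v; u] by rewrite setUC.
have vu : gE G v u by rewrite sG.1.
have [] := near u v setT uv eE (in_setT _) (fun z _ => in_setT z); rewrite -/Z => C1 C2.
have [] := near v u setT vu vuE (in_setT _) (fun z _ => in_setT z); rewrite -/Z => D1 D2.
have [||] := near v u (setT :\ u) vu vuE.
- by rewrite !inE eq_sym uv'.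
- by move=> z; rewrite !inE negb_or => /andP[_ ->].
rewrite -/Z => B1 _.
rewrite /= subsetT -/Z [matchsum t (w (rcons done e)) es setT](matchsum_field2 t (w := w done) _ uv');
  last first.
  move=> y yu yv; rewrite /w -cats1 count_cat /= eE !inE (negPf yu) (negPf yv) /=.
  by rewrite !addn0.
have wE y : y \in e -> w (rcons done e) y - w done y = t * x.
  by move=> ye; rewrite /w -cats1 count_cat /= ye addn0 natrD /=; ring.
rewrite !wE ?eE ?set21 ?set22 // -/Z -setDDl.
set A := Z setT in C1 C2 D1 D2 *; set C := Z (_ :\ u) in C1 C2 B1 *.
set D := Z (_ :\ v) in D1 D2 *; set B := Z _ in B1 *.
have [A0 B0 C0 D0] : [/\ 0 < A, 0 < B, 0 < C & 0 < D] by split; apply: Z0.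
have k1' : 0 <= 1 - k by rewrite subr_ge0.
have lowC : x * A * (1 - k) <= C.
  apply: le_trans (ler_wpM2r k1' C2) _.
  have : 0 <= k ^+ 2 * C by rewrite mulr_ge0 ?sqr_ge0 // ltW.
  lra.
have lowD : x * A * (1 - k) <= D.
  apply: le_trans (ler_wpM2r k1' D2) _.
  have : 0 <= k ^+ 2 * D by rewrite mulr_ge0 ?sqr_ge0 // ltW.
  lra.
have upB : B <= (1 + 3 * k) * (x ^+ 2 * A).
  apply: le_trans B1 _.
  apply: le_trans (ler_wpM2l _ C1) _; first by rewrite mulr_ge0 ?addr_ge0 // ltW.
  have -> : (1 + k) * x * ((1 + k) * x * A) = (1 + 2 * k + k * k) * (x ^+ 2 * A) by ring.
  apply: ler_wpM2r; first by rewrite mulr_ge0 ?sqr_ge0 // ltW.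
  have : k * k <= k by rewrite ler_piMl.
  lra.
(* The constant 5: [B] contributes 3 since (1 + k)^2 <= 1 + 3 k for k <= 1, and [C] and [D]
   contribute 1 each. *)
have key : B + x ^+ 2 * A - x * C - x * D <= 5 * k * A.
  have h1 := ler_wpM2l (ltW x_gt0) lowC; have h2 := ler_wpM2l (ltW x_gt0) lowD.
  have h3 : k * (x ^+ 2 * A) <= k * A.
    by rewrite ler_wpM2l // ler_piMl ?exprn_ile1 // ltW.
  lra.
have tx0 : 0 <= t * x by rewrite mulr_ge0 // ltW.
have h1 := ler_wpM2l t_ge0 key.
have h2 : 0 <= 5 * t * k * (t * x * C + t * x * D + t * x * (t * x) * B).
  apply: mulr_ge0; first by rewrite mulr_ge0 // mulr_ge0.
  by rewrite !addr_ge0 // mulr_ge0 ?(ltW B0) ?(ltW C0) ?(ltW D0) // mulr_ge0.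
lra.
Qed.

End Path.

Lemma girth_upper_bound n : (n.+1 < L.-1)%N -> let k := (1 - x) ^+ n * (t * d%:R) in
  k <= 1 ->
  (1 + t * x ^+ 2) ^+ size (edges G) * matchsum t (fun=> 1) (edges G) setT <=
  (1 + 5 * t * k) ^+ size (edges G) * (1 + t * d%:R * x) ^+ #|gV G|.
Proof.
move=> nL k k1.
(* Generalised over the traded prefix [done]; when no edge is left, regularity gives every vertex
   the weight 1 + t d x. *)
suff H done es : edges G = done ++ es ->
    (1 + t * x ^+ 2) ^+ size es * matchsum t (w done) es setT <=
    (1 + 5 * t * k) ^+ size es * (1 + t * d%:R * x) ^+ #|gV G|.
  have := H [::] (edges G) erefl.
  by rewrite (@eq_matchsum _ _ t (w [::]) (fun=> 1)) // => y _; rewrite /w mulr0 addr0.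
elim: es done => [|e es IH] done splitE.
  rewrite !expr0 !mul1r /= (eq_bigl xpredT) => [|y]; last by rewrite inE.
  rewrite (eq_bigr (fun=> 1 + t * d%:R * x)); first by rewrite prodr_const.
  move=> y _; rewrite /w -(count_edges sG y rG) splitE cats0; ring.
have k0 : 0 <= k by rewrite !mulr_ge0 // exprn_ge0 // subr_ge0.
have h := field_step splitE nL k1.
have -> : size (e :: es) = (size es).+1 by [].
rewrite ![_ ^+ (size es).+1]exprSr -[leLHS]mulrA.
apply: le_trans (ler_wpM2l _ h) _.
  by rewrite exprn_ge0 // addr_ge0 // mulr_ge0 // sqr_ge0.
rewrite [leLHS]mulrCA [_ ^+ _ * (1 + 5 * t * k)]mulrC -[leRHS]mulrA ler_wpM2l //.
  by rewrite addr_ge0 // mulr_ge0 // mulr_ge0.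
by apply: IH; rewrite cat_rcons.
Qed.

End LargeGirth.

(** * Real-rootedness and the matching measure *)

Section Expansion.
Variable V : finType.
Implicit Types (S e : {set V}) (es : seq {set V}) (M : {set {set V}}).

Lemma trivIset_setU1 M e : e \notin M ->
  trivIset (e |: M) = trivIset M && (cover M \subset ~: e).
Proof.
move=> eM; apply/idP/andP => [tM|[/trivIsetP tM cM]].
  split; first by apply: trivIsetS tM; apply: subsetUr.
  apply/bigcupsP => A AM; rewrite -disjoints_subset.
  by apply: (trivIsetP tM); rewrite ?setU11 ?setU1r //; apply: contraNneq eM => <-.
have dM A : A \in M -> [disjoint A & e].
  by move=> AM; rewrite disjoints_subset; apply: subset_trans cM; apply: bigcup_sup.
apply/trivIsetP => A B /setU1P[->|AM] /setU1P[->|BM]; rewrite ?eqxx // => AB.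
- by rewrite disjoint_sym dM.
- exact: dM.
- exact: tM.
Qed.

(** Matchings avoiding the head edge [e] give the first summand of the recursion; removing [e] from
    the others yields the matchings inside [S :\: e]. *)
Lemma matchsum_sum_matchings (K : comNzRingType) (t w : K) es S :
  uniq es -> {in es, forall e, #|e| = 2%N} ->
  \sum_(M : {set {set V}} | [&& M \subset es, trivIset M & cover M \subset S])
     t ^+ #|M| * w ^+ (#|S| - 2 * #|M|) = matchsum t (fun=> w) es S.
Proof.
elim: es S => [|e es IH] S /=.
  move=> _ _; rewrite (big_pred1 set0) => [|M].
    by rewrite cards0 expr0 mul1r muln0 subn0 prodr_const.
  apply/and3P/eqP => [[/subsetP M0 _ _]|->].
    by apply/eqP; rewrite -subset0; apply/subsetP => A /M0.
  rewrite /cover big_set0 sub0set; split=> //.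
    by apply/subsetP => x; rewrite inE.
  by apply/trivIsetP => A B; rewrite inE.
case/andP => ees ues He.
have Hes : {in es, forall e : {set V}, #|e| = 2%N} by move=> f fes; apply: He; rewrite inE fes orbT.
have e2 : #|e| = 2%N by apply: He; rewrite mem_head.
rewrite (bigID (fun M => e \notin M)) /=; congr (_ + _).
  rewrite -IH //; apply: eq_bigl => M; rewrite -!andbA.
  have -> : (M \subset es) = (M \subset e :: es) && (e \notin M).
    apply/idP/andP => [Mes|[/subsetP Mes eM]].
      split; last by apply: contra ees => /(subsetP Mes).
      by apply: subset_trans Mes _; apply/subsetP => f; rewrite inE => ->; rewrite orbT.
    apply/subsetP => f fM; move: (Mes f fM); rewrite inE => /orP[/eqP fe|//].
    by rewrite -fe fM in eM.
  by case: (_ \subset e :: es); case: (e \notin M); rewrite /= ?andbT ?andbF.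
rewrite (reindex_onto (fun M => e |: M) (fun M => M :\ e)) /=; last first.
  by move=> M /andP[_ /negbNE eM]; rewrite setD1K.
have predE M : [&& e |: M \subset e :: es, trivIset (e |: M) & cover (e |: M) \subset S]
     && ~~ (e \notin e |: M) && ((e |: M) :\ e == M) =
   (e \subset S) && [&& M \subset es, trivIset M & cover M \subset S :\: e].
  rewrite setU11 andbT.
  have -> : ((e |: M) :\ e == M) = (e \notin M).
    by apply/eqP/idP => [<-|/setU1K //]; rewrite !inE eqxx.
  have [eM|eM] := boolP (e \in M); rewrite /= ?andbF ?andbT.
    apply/esym/negP => /and4P[_ /subsetP Mes _ _].
    by rewrite (Mes _ eM) in ees.
  rewrite trivIset_setU1 // /cover big_setU1 //= subUset -/(cover M).
  have -> : (e |: M \subset e :: es) = (M \subset es).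
    apply/subsetP/subsetP => [H f fM|H f].
      move: (H f); rewrite setU1r // inE => /(_ isT) /orP[/eqP fe|//].
      by rewrite -fe fM in eM.
    by move=> /setU1P[->|/H]; rewrite !inE ?eqxx // => ->; rewrite orbT.
  rewrite setDE subsetI.
  by case: (M \subset es); case: (trivIset M); case: (e \subset S);
     case: (cover M \subset S); case: (cover M \subset ~: e).
rewrite (eq_bigl _ _ predE); case: ifP => eS; last by rewrite big_pred0.
rewrite -IH // big_distrr /=; apply: eq_bigr => M /and3P[Mes _ _].
have eM : e \notin M by apply: contra ees => /(subsetP Mes).
have -> : #|S| = (2 + #|S :\: e|)%N by rewrite -e2 -(cardsID e S) (setIidPr eS).
by rewrite cardsU1 eM add1n exprS mulnS subnDl mulrA.
Qed.

Lemma card_cover2 es M : {in es, forall e, #|e| = 2%N} -> M \subset es ->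
  trivIset M -> (2 * #|M|)%N = #|cover M|.
Proof.
move=> He /subsetP Mes /eqP <-; rewrite mulnC -sum_nat_const.
by apply: eq_bigr => e eM; rewrite He // Mes.
Qed.

End Expansion.

Lemma is_matchingE (G : fin_graph) (M : {set {set gV G}}) :
  is_matching M = (M \subset edges G) && trivIset M.
Proof.
rewrite /is_matching; congr (_ && _).
  apply/forall_inP/subsetP => [H e eM|H e eM].
    by rewrite mem_enum inE; apply: H.
  by have := H e eM; rewrite mem_enum inE.
apply/forall_inP/trivIsetP => [H A B AM BM AB|H A AM].
  by have /forall_inP/(_ B BM)/implyP := H A AM; apply.
by apply/forall_inP => B BM; apply/implyP => AB; apply: H.
Qed.

Lemma matching_polyE (K : comNzRingType) (G : fin_graph) : simple_graph G ->
  matching_poly K G = matchsum (-1) (fun=> 'X) (edges G) setT.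
Proof.
move=> sG; have c2 : {in edges G, forall e : {set gV G}, #|e| = 2%N} by move=> e; apply: card_edge.
rewrite -matchsum_sum_matchings ?edges_uniq //.
(* A matching covers twice its size in vertices, so the cut-off of [matching_poly] at half the
   vertices loses nothing and [inord] below is faithful. *)
have szM (M : {set {set gV G}}) : is_matching M -> (#|M| < (nverts G)./2.+1)%N.
  rewrite is_matchingE => /andP[Mes tM]; rewrite ltnS.
  have := max_card (mem (cover M)); rewrite -(card_cover2 c2 Mes tM) mul2n.
  by move/half_leq; rewrite doubleK.
rewrite (eq_bigl (@is_matching G)) => [|M]; last first.
  by rewrite is_matchingE subsetT andbT.
rewrite (partition_big (fun M : {set {set gV G}} => inord #|M| : 'I_(nverts G)./2.+1) xpredT) //=.
apply: eq_bigr => k _.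
rewrite (eq_bigr (fun=> (-1) ^+ k * 'X^(nverts G - 2 * k))); last first.
  move=> M /andP[/szM Mn /eqP <-]; by rewrite inordK // cardsT.
rewrite sumr_const -scaler_nat mulrC -scalerA /nmatchings.
have -> : #|[set M : {set {set gV G}} | is_matching M && (#|M| == k)]| =
   #|[pred M : {set {set gV G}} | is_matching M & inord #|M| == k]|.
  apply: eq_card => M; rewrite !inE; case mM: (is_matching M) => //=.
  by rewrite -(inj_eq val_inj) /= inordK ?szM.
by congr (_ *: _); rewrite -mul_polyC rmorphXn rmorphN1.
Qed.

(** The empty matching gives the leading term, and each edge used lowers the degree by two. *)
Lemma matchsum_monic (K : comNzRingType) (V : finType) es (S : {set V}) (c : K) :
  {in es, forall e : {set V}, #|e| = 2%N} ->
  let p := matchsum c%:P (fun=> 'X) es S in p \is monic /\ size p = #|S|.+1.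
Proof.
elim: es S => [|e es IH] S He /=.
  by rewrite prodr_const monicXn size_polyXn.
have Hes : {in es, forall e : {set V}, #|e| = 2%N} by move=> f fes; apply: He; rewrite inE fes orbT.
have [m1 s1] := IH S Hes; case: ifP => eS; last by rewrite addr0.
have [_ s2] := IH (S :\: e) Hes.
have lt : (size (c%:P * matchsum c%:P (fun=> 'X) es (S :\: e))%R <
  size (matchsum c%:P (fun=> 'X) es S))%N.
  rewrite mul_polyC s1 (leq_ltn_trans (size_scale_leq _ _)) // s2 ltnS.
  rewrite -(cardsID e S) (setIidPr eS) (He e) ?mem_head //.
by split; [rewrite monicE lead_coefDl // -monicE | rewrite size_polyDl].
Qed.

(** * The Heilmann-Lieb theorem *)

Section HeilmannLieb.
Variables (R : rcfType) (V : finType).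
Local Notation C := R[i].
Implicit Types (es : seq {set V}) (S : {set V}).

(* [cross a b] is the imaginary part of [a * b^*]. *)
Let cross (a b : C) : R := complex.Im a * complex.Re b - complex.Re a * complex.Im b.

Let crossD (a a' b : C) : cross (a + a') b = cross a b + cross a' b.
Proof. by case: a a' b => [a1 a2] [a'1 a'2] [b1 b2]; rewrite /cross /=; ring. Qed.

Let crossC (a b : C) : cross a b = - cross b a.
Proof. by case: a b => [a1 a2] [b1 b2]; rewrite /cross /=; ring. Qed.

Let crossN (a b : C) : cross (- a) b = cross b a.
Proof. by case: a b => [a1 a2] [b1 b2]; rewrite /cross /=; ring. Qed.

Let cross0 (b : C) : cross 0 b = 0.
Proof. by case: b => [b1 b2]; rewrite /cross /=; ring. Qed.

Let cross_sum I (r : seq I) (P : pred I) (F : I -> C) (b : C) :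
  cross (\sum_(i <- r | P i) F i) b = \sum_(i <- r | P i) cross (F i) b.
Proof. by apply: (big_morph (fun a => cross a b)) => [a a'|]; rewrite ?crossD ?cross0. Qed.

Let crossMl (z b : C) : 0 < complex.Im z -> b != 0 -> 0 < cross (z * b) b.
Proof.
case: z b => [z1 z2] [b1 b2] /= z0; rewrite eq_complex /= negb_and => b0.
have -> : cross (Complex z1 z2 * Complex b1 b2) (Complex b1 b2) =
   z2 * (b1 ^+ 2 + b2 ^+ 2) by rewrite /cross /=; ring.
rewrite mulr_gt0 // lt_neqAle addr_ge0 ?sqr_ge0 // andbT eq_sym.
by rewrite paddr_eq0 ?sqr_ge0 // !sqrf_eq0 negb_and.
Qed.

(** The ratio Z(S) / Z(S - u) equals [z] minus a sum of inverses of such ratios for smaller sets.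
    Minus the inverse maps the upper half-plane to itself, so by induction all ratios stay there;
    [cross] expresses this without division. *)
Lemma matchsum_upper_half es (z : C) S : {in es, forall e : {set V}, #|e| = 2%N} ->
  0 < complex.Im z -> matchsum (-1) (fun=> z) es S != 0.
Proof.
move=> He z0; set Z := matchsum (-1) (fun=> z) es.
suff [nz _] : Z S != 0 /\ {in S, forall u, 0 < cross (Z S) (Z (S :\ u))} by [].
have [n] := ubnP #|S|; elim: n => // n IH in S *; rewrite ltnS => Sn.
have step u : u \in S -> 0 < cross (Z S) (Z (S :\ u)).
  move=> uS; have Sun : (#|S :\ u| < n)%N by rewrite (cardsD1 u S) uS in Sn.
  have [nz pos] := IH _ Sun.
  rewrite {1}/Z (matchsum_vertex _ _ es uS) -/Z crossD mulN1r crossN (crossC (Z (S :\ u))).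
  rewrite cross_sum -sumrN ltr_wpDr ?crossMl // big_seq_cond sumr_ge0 //.
  move=> e /andP[ees /andP[ue eS]]; rewrite -crossC.
  have /cards1P[a ea] : #|e :\ u| == 1%N by rewrite -eqSS -add1n -(He e ees) (cardsD1 u e) ue.
  have -> : S :\: e = S :\ u :\ a by rewrite setDDl -ea setD1K.
  by rewrite ltW // pos // -sub1set -ea setSD.
split; last exact: step.
have [->|[u uS]] := set_0Vmem S; last first.
  by apply: contraTneq (step u uS) => ->; rewrite cross0 ltxx.
suff -> : Z set0 = 1 by rewrite oner_neq0.
rewrite /Z; elim: es He {Z IH step} => [|e es IHe] He /=; first by rewrite big_set0.
rewrite IHe => [|f fes]; last by apply: He; rewrite inE fes orbT.
rewrite subset0 ifN ?addr0 //; apply/eqP => e0.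
by have := He e (mem_head _ _); rewrite e0 cards0.
Qed.

(** The lower half-plane reduces to the upper one by homogeneity with [l = -1]. *)
Lemma matchsum_nonreal es (z : C) S : {in es, forall e : {set V}, #|e| = 2%N} ->
  complex.Im z != 0 -> matchsum (-1) (fun=> z) es S != 0.
Proof.
move=> He; have [z0 _|z0 _|//] := ltgtP 0 (complex.Im z).
  exact: matchsum_upper_half.
have : matchsum (-1) (fun=> - z) es S != 0.
  by apply: matchsum_upper_half => //; case: z z0 => a b /=; rewrite oppr_gt0.
have -> : matchsum (-1) (fun=> - z) es S =
   matchsum ((-1) ^+ 2 * -1) (fun=> -1 * z) es S.
  by rewrite sqrrN expr1n mul1r; apply: eq_matchsum => v _; rewrite mulN1r.
by rewrite matchsum_scale // mulf_eq0 negb_or => /andP[].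
Qed.

End HeilmannLieb.

(** * From zeros of the matching polynomial to the matching generating function *)

Lemma matching_poly_split (R : rcfType) (G : fin_graph) : simple_graph G ->
  exists rs : seq R, matching_poly R G = \prod_(r <- rs) ('X - r%:P) /\
    forall t, 0 < t ->
    matchsum t (fun=> 1) (edges G) setT ^+ 2 = \prod_(r <- rs) (1 + t * r ^+ 2).
Proof.
move=> sG; set p := matching_poly R G; set es := edges G.
have He : {in es, forall e : {set gV G}, #|e| = 2%N} by move=> e; apply: card_edge.
have hornerC z : (map_poly (real_complex R) p).[z] = matchsum (-1) (fun=> z) es setT.
  rewrite /p matching_polyE // rmorph_matchsum -/(horner_eval z _) rmorph_matchsum.
  rewrite rmorphN1 /= rmorphN1; apply: eq_matchsum => v _ /=.
  by rewrite /horner_eval map_polyX hornerX.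
have [pm ps] : p \is monic /\ size p = #|[set: gV G]|.+1.
  by rewrite /p matching_polyE // -(rmorphN1 polyC); apply: matchsum_monic.
have [zs Ezs] := closed_field_poly_normal (map_poly (real_complex R) p).
have lc : lead_coef (map_poly (real_complex R) p) = 1 by rewrite lead_coef_map (monicP pm) rmorph1.
rewrite lc scale1r in Ezs.
have zsR z : z \in zs -> z = (real_complex R) (complex.Re z).
  move=> zzs; have : (map_poly (real_complex R) p).[z] == 0.
    by rewrite -/(root _ z) Ezs root_prod_XsubC.
  rewrite hornerC => Z0; case: z zzs Z0 => a b _ /= Z0.
  have [->|b0] := eqVneq b 0; first by [].
  by rewrite (negPf (matchsum_nonreal _ He _)) in Z0.
exists (map (@complex.Re R) zs).
have pE : p = \prod_(r <- [seq complex.Re z | z <- zs]) ('X - r%:P).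
  apply: (map_poly_inj (real_complex R)); rewrite Ezs rmorph_prod big_map big_seq [RHS]big_seq.
  apply: eq_bigr => z zzs; rewrite rmorphB /= map_polyX map_polyC.
  by congr (_ - _%:P); apply: zsR.
split => // t t0; set M := matchsum t _ _ _; set rs := map _ _ in pE *.
have sz : size rs = #|[set: gV G]|.
  by apply: succn_inj; rewrite -ps pE size_prod_XsubC.
(* By homogeneity the polynomial at [l] is [l ^+ size rs] times [M]. Using both square roots [l] and
   [- l] of -1/t and multiplying gives factors 1 - r^2/l^2 = 1 + t r^2, whence the square of [M]. *)
have prodE (l : R[i]) : l != 0 -> l ^+ 2 * (real_complex R) t = -1 ->
    (real_complex R) M = \prod_(r <- rs) (1 - (real_complex R) r / l).
  move=> l0 lt; apply: (mulfI (expf_neq0 (size rs) l0)).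
  have -> : l ^+ size rs * (real_complex R) M = (map_poly (real_complex R) p).[l].
    rewrite hornerC sz /M rmorph_matchsum -lt.
    have -> : matchsum (l ^+ 2 * (real_complex R) t) (fun=> l) es setT =
      matchsum (l ^+ 2 * (real_complex R) t) (fun=> l * 1) es setT.
      by apply: eq_matchsum => v _; rewrite mulr1.
    by rewrite matchsum_scale //; congr (_ * _); apply: eq_matchsum => v _ /=; rewrite rmorph1.
  have -> : l ^+ size rs = \prod_(r <- rs) l.
    by rewrite big_const_seq iter_mulr_1 count_predT.
  rewrite pE rmorph_prod horner_prod -big_split; apply: eq_bigr => r _ /=.
  by rewrite rmorphB /= map_polyX map_polyC /= !hornerE; field.
pose l : R[i] := sqrtc (- ((real_complex R) t)^-1).
have t0C : (real_complex R) t != 0 by rewrite fmorph_eq0 gt_eqF.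
have l2 : l ^+ 2 = - ((real_complex R) t)^-1 by rewrite sqr_sqrtc.
have l0 : l != 0 by rewrite -sqrf_eq0 l2 oppr_eq0 invr_eq0.
have lt : l ^+ 2 * (real_complex R) t = -1 by rewrite l2 mulNr mulVf.
apply: (@complexI R); rewrite rmorphXn /= expr2.
rewrite {1}(prodE l l0 lt) (prodE (- l)) ?oppr_eq0 ?sqrrN // rmorph_prod -big_split /=.
apply: eq_bigr => r _; rewrite rmorphD rmorphM rmorphXn rmorph1 /=.
have -> : (real_complex R) t = - (l ^+ 2)^-1 by rewrite l2 invrN invrK opprK.
by field.
Qed.

(** The polynomial splits over the reals, so the distinct real roots with multiplicities exhaust
    [rs]; the factor 1/2 undoes the square in [matching_poly_split]. *)
Lemma int_rhoE (R : realType) (G : fin_graph) (t : R) : simple_graph G -> 0 < t ->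
  int_rho G (fun z : R => 2^-1 * ln (1 + t * z ^+ 2)) =
  (nverts G)%:R^-1 * ln (matchsum t (fun=> 1) (edges G) setT).
Proof.
move=> sG t0; rewrite /int_rho; congr (_ * _).
have [rs [pE M2]] := matching_poly_split R sG.
pose f z : R := 2^-1 * ln (1 + t * z ^+ 2); set p := matching_poly R G in pE *.
have p0 : p != 0 by rewrite pE monic_neq0 // monic_prod_XsubC.
have mupE z : mup z p = count_mem z rs.
  rewrite pE; elim: rs {pE M2} => [|r rs IH].
    by rewrite big_nil mupNroot // root1.
  rewrite big_cons mupM ?polyXsubC_eq0 ?monic_neq0 ?monic_prod_XsubC // IH.
  by rewrite -['X - r%:P]expr1 mup_XsubCX /=; case: (r == z).
transitivity (\sum_(z <- rs) f z).
  rewrite -[RHS]big_undup_iterop_count.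
  rewrite (perm_big (undup rs)) /=.
    by apply: eq_bigr => z _; rewrite mupE mulr_natl Monoid.iteropE iter_addr_0.
  apply: uniq_perm; rewrite ?undup_uniq ?uniq_roots // => z.
  rewrite mem_undup -(roots_on_rootsR p0) in_itv /=.
  by rewrite pE root_prod_XsubC.
have M0 : 0 < matchsum t (fun=> 1) (edges G) setT by apply: matchsum_gt0 => //; exact: ltW.
have pos r : 0 < 1 + t * r ^+ 2 by rewrite ltr_wpDr // mulr_ge0 ?sqr_ge0 // ltW.
have lnprod : ln (\prod_(r <- rs) (1 + t * r ^+ 2)) = \sum_(r <- rs) ln (1 + t * r ^+ 2).
  elim: rs {pE M2 mupE} => [|r rs IH]; first by rewrite !big_nil ln1.
  by rewrite !big_cons lnM ?posrE ?IH // prodr_gt0.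
rewrite /f -mulr_sumr -lnprod -(M2 t t0) lnXn //.
by rewrite -mulr_natl; field.
Qed.

(** * Comparison *)

Lemma exprn_lt_eps (R : realType) (x eps : R) : 0 < x <= 1 -> 0 < eps ->
  exists n, (1 - x) ^+ n < eps.
Proof.
move=> /andP[x0 x1] e0; pose n := (Num.bound (x * eps)^-1); exists n.
have nb : (x * eps)^-1 < n%:R.
  by apply: archi_boundP; rewrite invr_ge0 mulr_ge0 // ltW.
apply: (@le_lt_trans _ _ (expR (- x) ^+ n)).
  by apply: lerXn2r; rewrite ?nnegrE ?subr_ge0 ?expR_ge0 // expR_ge1Dx.
rewrite -expRM_natr mulNr expRN invf_plt ?posrE ?expR_gt0 //.
apply: lt_le_trans (expR_ge1Dx _).
have h : eps^-1 < x * n%:R.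
  rewrite -ltr_pdivrMl //; apply: le_lt_trans nb.
  by rewrite invfM.
by apply: lt_trans h _; rewrite ltrDr.
Qed.

(* int (1/2) ln(1+t z^2) d rho_G >= int (1/2) ln(1+t z^2) d rho_{T_d},
   where the right-hand side is the limit of the same integrals along any
   sequence of finite d-regular graphs with girth -> infinity; we state it as
   "limsup_i int f d rho_{G_i} <= int f d rho_G" for every such sequence. *)
Theorem theorem4p7 (R : realType) (d : nat) (G : fin_graph) (t : R) :
  (1 <= d)%N -> simple_graph G -> regular d G -> bipartite G ->
  (0 < nverts G)%N -> 0 <= t ->
  forall Gs : nat -> fin_graph, tree_approx_seq d Gs ->
  forall eps : R, 0 < eps ->
  exists N : nat, forall i : nat, (N <= i)%N ->
    int_rho (Gs i) (fun z : R => 2^-1 * ln (1 + t * z ^+ 2))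
      <= int_rho G (fun z : R => 2^-1 * ln (1 + t * z ^+ 2)) + eps.
Proof.
move=> d0 sG rG [c cG] nG t_ge0 Gs [Gs_ok girth] eps eps0.
(* At [t = 0] both integrands vanish; the formula for the integral is available for positive [t]. *)
have [t0|t0] := eqVneq t 0.
  have int0 H : int_rho H (fun z : R => 2^-1 * ln (1 + t * z ^+ 2)) = 0.
    rewrite /int_rho big1 ?mulr0 // => z _.
    by rewrite t0 mul0r addr0 ln1 !mulr0.
  by exists 0%N => i _; rewrite !int0 add0r ltW.
have t_gt0 : 0 < t by rewrite lt_neqAle eq_sym t0.
(* The positive root of x + c0 x^2 = 1, rationalised so that it also makes sense for [d = 1], where
   [c0] is zero. *)
pose c0 : R := t * d.-1%:R; pose q := Num.sqrt (1 + 4 * c0).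
pose x := 2 / (1 + q).
have c0_ge0 : 0 <= c0 by rewrite mulr_ge0.
have q2 : q ^+ 2 = 1 + 4 * c0 by rewrite sqr_sqrtr // addr_ge0 // mulr_ge0.
have q1 : 0 < 1 + q by rewrite ltr_pwDl // sqrtr_ge0.
have x0 : 0 < x by rewrite divr_gt0.
have xE : x + t * d.-1%:R * x ^+ 2 = 1.
  have -> : t * d.-1%:R = (q ^+ 2 - 1) / 4 by rewrite q2 /c0; field.
  by rewrite /x; field; rewrite gt_eqF.
have x1 : x <= 1 by rewrite -xE lerDl mulr_ge0 ?sqr_ge0.
pose D : R := d%:R; have D0 : 0 < D by rewrite ltr0n.
have tD : 0 < t * D by rewrite mulr_gt0.
have tx : 0 < 1 + t * x ^+ 2 by rewrite ltr_wpDr // mulr_ge0 ?sqr_ge0.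
have tdx : 0 < 1 + t * D * x by rewrite ltr_wpDr // mulr_ge0 // ltW.
(* The Bethe value per vertex; a [d]-regular graph has [d / 2] edges per vertex. *)
pose L0 := ln (1 + t * D * x) - D / 2 * ln (1 + t * x ^+ 2).
have edgeD H : simple_graph H -> regular d H ->
    (size (edges H))%:R = (nverts H)%:R * (D / 2) :> R.
  move=> sH rH; have := congr1 (fun n => n%:R : R) (handshake sH rH).
  by rewrite !natrM => E; rewrite mulrA -E; field.
have lnX (y : R) m : 0 < y -> ln (y ^+ m) = m%:R * ln y.
  by move=> y0; rewrite lnXn // mulr_natl.
have lower : L0 <= int_rho G (fun z : R => 2^-1 * ln (1 + t * z ^+ 2)).
  have cP : proper_colouring c (edges G).
    by move=> e /edgesP[u [v [uv ->]]]; exists u, v; split=> //; apply: cG.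
  have := bethe_lower_bound t_ge0 cP (edges_uniq G) x0 (fun y => count_edges sG y rG).
  have M0 : 0 < matchsum t (fun=> 1) (edges G) setT by apply: matchsum_gt0.
  rewrite -ler_ln ?posrE ?mulr_gt0 ?exprn_gt0 // lnM ?posrE ?exprn_gt0 // !lnX //.
  rewrite edgeD // int_rhoE //.
  have nG0 : 0 < (nverts G)%:R :> R by rewrite ltr0n.
  rewrite -/(nverts G) mulrC -lerBlDr => h.
  rewrite ler_pdivlMl //; apply: le_trans h; rewrite /L0 -/D; lra.
(* Chosen so that (D/2) (5 t del) = eps: an error factor 1 + 5 t k per edge, with [D / 2] edges per
   vertex and ln (1 + y) <= y. *)
pose del := eps * (2 / 5) / (t * D).
have del0 : 0 < del by rewrite !mulr_gt0 ?invr_gt0 // mulr_gt0.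
have m0 : 0 < Num.min 1 del / (t * D) by rewrite divr_gt0 // lt_min ltr01.
have [n hn] := exprn_lt_eps (introT andP (conj x0 x1)) m0.
pose k := (1 - x) ^+ n * (t * D).
have k0 : 0 <= k by rewrite mulr_ge0 ?exprn_ge0 ?subr_ge0 // ltW.
have [k1 kdel] : k <= 1 /\ k <= del.
  move: hn; rewrite ltr_pdivlMr // -/k lt_min => /andP[] h1 h2.
  by split; apply: ltW.
(* With [L = n + 3] the requirement [n.+1 < L.-1] just holds. *)
have [N HN] := girth n.+3; exists N => i Ni.
have [sH rH nH] := Gs_ok i; set H := Gs i in sH rH nH *.
apply: le_trans (lerD lower (lexx eps)).
have gH l : (l <= n.+3)%N -> ~ has_cycle_of_len H l by apply: HN.
have := girth_upper_bound t_ge0 x0 xE sH rH gH (ltnSn n.+1) k1.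
have M0 : 0 < matchsum t (fun=> 1) (edges H) setT by apply: matchsum_gt0.
have K0 : 0 < 1 + 5 * t * k by rewrite ltr_wpDr // mulr_ge0 // mulr_ge0.
rewrite -/D -/k -ler_ln ?posrE ?mulr_gt0 ?exprn_gt0 // !lnM ?posrE ?exprn_gt0 // !lnX //.
rewrite edgeD // int_rhoE //.
have nH0 : 0 < (nverts H)%:R :> R by rewrite ltr0n.
rewrite -/(nverts H) => h; rewrite ler_pdivrMl //.
have lnk : D / 2 * ln (1 + 5 * t * k) <= eps.
  apply: (@le_trans _ _ (D / 2 * (5 * t * k))).
    rewrite ler_wpM2l ?divr_ge0 // -[leRHS]expRK ler_ln ?posrE ?expR_gt0 //.
    exact: expR_ge1Dx.
  apply: (@le_trans _ _ (D / 2 * (5 * t * del))).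
    by rewrite ler_wpM2l ?divr_ge0 // ler_wpM2l // mulr_ge0.
  by rewrite le_eqVlt; apply/orP; left; apply/eqP; rewrite /del; field; rewrite !gt_eqF.
have := ler_wpM2l (ltW nH0) lnk.
rewrite /L0; lra.
Qed.
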